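(* Let $\iota:\mathbf{TcOSC}\hookrightarrow\mathbf{WkRPC}$ be the inclusion functor. Then the pull-back system of one-step homotopies along $\iota$ is $$\iota^\ast\mathcal S_{\mathbf{WkRPC}}=\mathcal S_{\mathbf{TcOSC}}.$$
   Context: An elementary path on a set $V$ is a finite non-empty sequence $v_0\dots v_k$ of elements of $V$; it is irregular if $v_i=v_{i+1}$ for some $i$, regular otherwise, simplicial if all $v_i$ are distinct. A path complex on $V$ is a set $P$ of elementary paths on $V=V(P)$ containing all singletons and closed under deleting the first or last vertex; it is regular if all its paths are regular. An ordered simplicial complex on $V=V(K)$ is a set $K$ of simplicial paths containing all singletons and closed under deleting any one vertex. A weak path morphism $P_1\to P_2$ is a map $f:V(P_1)\to V(P_2)$ such that for each $p\in P_1$, $f(p)$ is irregular or in $P_2$ ($f$ applied vertexwise). A triangle-collapsing simplicial morphism $K_1\to K_2$ is a map $f:V(K_1)\to V(K_2)$ such that for each $p\in K_1$, $f(p)$ is non-simplicial or in $K_2$, and such that $v_0v_1v_2\in K_1$ with $f(v_0)=f(v_2)$ implies $f(v_0)=f(v_1)=f(v_2)$. $\mathbf{WkRPC}$: regular path complexes with weak path morphisms. $\mathbf{TcOSC}$: ordered simplicial complexes with triangle-collapsing simplicial morphisms; it is a full subcategory of $\mathbf{WkRPC}$. A system of one-step homotopies $\mathcal S$ for a category $\mathcal C$ is a choice, for every pair of objects $C_1,C_2$, of a simple digraph (no self-loops) $\mathcal S(C_1,C_2)$ with vertex set $\mathrm{Mor}_{\mathcal C}(C_1,C_2)$. For a functor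 $\mu:\mathcal C\to\mathcal D$ and a system $\mathcal S$ for $\mathcal D$, the pull-back $\mu^\ast\mathcal S$ is the system for $\mathcal C$ with, for distinct $f, g$, an edge $f\to g$ in $\mu^\ast\mathcal S(C_1,C_2)$ iff $\mu(f)=\mu(g)$ or $\mu(f)\to\mu(g)$ in $\mathcal S(\mu(C_1),\mu(C_2))$. The cylinder $\mathrm{Cyl}(P)$ over a path complex $P$ is the path complex on $V(P)\times\{0,1\}$ consisting of the paths $(v_0,0)\dots(v_k,0)$, $(v_0,1)\dots(v_k,1)$ and $(v_0,0)\dots(v_i,0)(v_i,1)\dots(v_k,1)$ for $0\le i\le k$, where $v_0\dots v_k\in P$. Write $\iota_j(v)=(v,j)$ for $j=0,1$. For an ordered simplicial complex $K$, all paths of $\mathrm{Cyl}(K)$ are simplicial, and $\overline{\mathrm{Cyl}(K)}$ denotes the smallest ordered simplicial complex containing $\mathrm{Cyl}(K)$. $\mathcal S_{\mathbf{WkRPC}}$: for distinct weak path morphisms $f,g:P_1\to P_2$ of regular path complexes, $f\to g$ iff there is a weak path morphism $F:\mathrm{Cyl}(P_1)\to P_2$ with $F\circ\iota_0=f$ and $F\circ\iota_1=g$. $\mathcal S_{\mathbf{TcOSC}}$: for distinct triangle-collapsing simplicial morphisms $f,g:K_1\to K_2$, $f\to g$ iff there is a triangle-collapsing simplicial morphism $F:\overline{\mathrm{Cyl}(K_1)}\to K_2$ with $F\circ\iota_0=f$ and $F\circ\iota_1=g$. *)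

(* Defs.v *)
From Stdlib Require Import List Classical ProofIrrelevance FinFun.
Import ListNotations.

Set Implicit Arguments.
Unset Strict Implicit.
Unset Printing Implicit Defensive.

(** Vertex sets are arbitrary types; the path [v_0 ... v_k] is the non-empty
    list [[v_0; ...; v_k]].  Non-emptiness is imposed on the members of a
    complex.  Accordingly, the closure conditions below only concern deletions
    that leave a non-empty sequence. *)

Definition irregular (V : Type) (p : list V) : Prop :=
  exists l v r, p = l ++ v :: v :: r.

Definition simplicial (V : Type) (p : list V) : Prop := NoDup p.

Definition is_path_complex (V : Type) (P : list V -> Prop) : Prop :=
  (forall p, P p -> p <> []) /\
  (forall v, P [v]) /\
  (forall v p, p <> [] -> P (v :: p) -> P p) /\
  (forall p v, p <> [] -> P (p ++ [v]) -> P p).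

Definition is_osc (V : Type) (K : list V -> Prop) : Prop :=
  (forall p, K p -> p <> [] /\ simplicial p) /\
  (forall v, K [v]) /\
  (forall l v r, l ++ r <> [] -> K (l ++ v :: r) -> K (l ++ r)).

Record path_complex : Type := PathComplex {
  vert : Type;
  paths : list vert -> Prop;
  path_complexP : is_path_complex paths }.

Definition regular (P : path_complex) : Prop :=
  forall p, @paths P p -> ~ irregular p.

Record rpc : Type := RPC {
  rpc_pc :> path_complex;
  rpc_regular : regular rpc_pc }.

Record osc : Type := OSC {
  overt : Type;
  opaths : list overt -> Prop;
  oscP : is_osc opaths }.

Definition is_weak_path_morphism (P1 P2 : path_complex)
    (f : vert P1 -> vert P2) : Prop :=
  forall p, paths p -> irregular (map f p) \/ paths (map f p).

Definition is_tc_morphism (K1 K2 : osc) (f : overt K1 -> overt K2) : Prop :=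
  (forall p, opaths p -> ~ simplicial (map f p) \/ opaths (map f p)) /\
  (forall v0 v1 v2, opaths [v0; v1; v2] -> f v0 = f v2 ->
     f v0 = f v1 /\ f v1 = f v2).

Record weak_path_morphism (P1 P2 : path_complex) : Type := WeakPathMorphism {
  wfun :> vert P1 -> vert P2;
  wfunP : is_weak_path_morphism wfun }.

Record tc_morphism (K1 K2 : osc) : Type := TcMorphism {
  tfun :> overt K1 -> overt K2;
  tfunP : is_tc_morphism tfun }.

Lemma weak_path_morphism_eq (P1 P2 : path_complex)
    (f g : weak_path_morphism P1 P2) : wfun f = wfun g -> f = g.
Proof.
destruct f as [f hf], g as [g hg]; simpl; intros ->.
f_equal; apply proof_irrelevance.
Qed.

Lemma tc_morphism_eq (K1 K2 : osc) (f g : tc_morphism K1 K2) :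
  tfun f = tfun g -> f = g.
Proof.
destruct f as [f hf], g as [g hg]; simpl; intros ->.
f_equal; apply proof_irrelevance.
Qed.

Record category : Type := Category {
  ob :> Type;
  mor : ob -> ob -> Type;
  idm : forall A, mor A A;
  comp : forall A B C, mor B C -> mor A B -> mor A C;
  comp_idl : forall A B (f : mor A B), comp (idm B) f = f;
  comp_idr : forall A B (f : mor A B), comp f (idm A) = f;
  comp_assoc : forall A B C D (h : mor C D) (g : mor B C) (f : mor A B),
    comp h (comp g f) = comp (comp h g) f }.

Record functor (C D : category) : Type := Functor {
  fob :> C -> D;
  fmap : forall A B : C, mor A B -> mor (fob A) (fob B);
  fmap_id : forall A : C, fmap (idm A) = idm (fob A);
  fmap_comp : forall (X Y Z : C) (g : mor Y Z) (f : mor X Y),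
    fmap (comp g f) = comp (fmap g) (fmap f) }.

Record system (C : category) : Type := System {
  edge : forall C1 C2 : C, mor C1 C2 -> mor C1 C2 -> Prop;
  edge_irrefl : forall (C1 C2 : C) (f : mor C1 C2), ~ edge f f }.

Definition pullback (C D : category) (mu : functor C D) (S : system D) :
  system C.
Proof.
refine (@System C (fun C1 C2 f g =>
  f <> g /\ (fmap mu f = fmap mu g \/ edge S (fmap mu f) (fmap mu g))) _).
intros C1 C2 f [nff _]; exact (nff eq_refl).
Defined.

Lemma irregular_map (V W : Type) (f : V -> W) (p : list V) :
  irregular p -> irregular (map f p).
Proof.
intros (l & v & r & ->); exists (map f l), (f v), (map f r).
now rewrite map_app.
Qed.

Definition weak_id (P : path_complex) : weak_path_morphism P P.
Proof.
refine (@WeakPathMorphism P P (fun v => v) _).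
intros p hp; right; now rewrite map_id.
Defined.

Definition weak_comp (P1 P2 P3 : path_complex) (g : weak_path_morphism P2 P3)
  (f : weak_path_morphism P1 P2) : weak_path_morphism P1 P3.
Proof.
refine (@WeakPathMorphism P1 P3 (fun v => g (f v)) _).
intros p hp; rewrite <- (map_map f g).
destruct (wfunP f hp) as [h | h].
- left; now apply irregular_map.
- exact (wfunP g h).
Defined.

Definition WkRPC : category.
Proof.
refine (@Category rpc (fun P1 P2 => weak_path_morphism P1 P2)
  (fun P => weak_id P) (fun P1 P2 P3 g f => weak_comp g f) _ _ _);
  intros; now apply weak_path_morphism_eq.
Defined.

Definition tc_id (K : osc) : tc_morphism K K.
Proof.
refine (@TcMorphism K K (fun v => v) _).
split.
- intros p hp; right; now rewrite map_id.
- intros v0 v1 v2 h e; subst v2; exfalso.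
  destruct (proj1 (oscP K) _ h) as [_ nd].
  inversion nd as [| x l n _]; apply n; simpl; auto.
Defined.

Definition tc_comp (K1 K2 K3 : osc) (g : tc_morphism K2 K3)
  (f : tc_morphism K1 K2) : tc_morphism K1 K3.
Proof.
refine (@TcMorphism K1 K3 (fun v => g (f v)) _).
destruct (tfunP f) as [f1 f2], (tfunP g) as [g1 g2].
split.
- intros p hp; rewrite <- (map_map f g).
  destruct (f1 p hp) as [h | h].
  + left; intros nd; apply h; exact (NoDup_map_inv _ _ nd).
  + exact (g1 _ h).
- intros v0 v1 v2 h e.
  destruct (classic (f v0 = f v2)) as [e02 | n02].
  { destruct (f2 _ _ _ h e02) as [-> ->]; auto. }
  destruct (classic (f v0 = f v1)) as [e01 | n01].
  { rewrite <- e01; auto. }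
  destruct (classic (f v1 = f v2)) as [e12 | n12].
  { rewrite e12; auto. }
  destruct (f1 _ h) as [ns | h'].
  + exfalso; apply ns; simpl.
    repeat constructor; simpl; intuition.
  + exact (g2 _ _ _ h' e).
Defined.

Definition TcOSC : category.
Proof.
refine (@Category osc (fun K1 K2 => tc_morphism K1 K2)
  tc_id (fun K1 K2 K3 g f => tc_comp g f) _ _ _);
  intros; now apply tc_morphism_eq.
Defined.

Lemma osc_path_complex (V : Type) (K : list V -> Prop) :
  is_osc K -> is_path_complex K.
Proof.
intros (h1 & h2 & h3); split; [|split; [|split]].
- intros p hp; exact (proj1 (h1 p hp)).
- exact h2.
- intros v p np; exact (h3 [] v p np).
- intros p v np hp; rewrite <- (app_nil_r p).
  apply (h3 p v []); [now rewrite app_nil_r | exact hp].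
Qed.

Definition osc_pc (K : osc) : path_complex :=
  PathComplex (osc_path_complex (oscP K)).

Lemma simplicial_not_irregular (V : Type) (p : list V) :
  simplicial p -> ~ irregular p.
Proof.
intros nd (l & v & r & ->); apply (NoDup_remove_2 _ _ _ nd).
apply in_or_app; simpl; auto.
Qed.

Lemma osc_regular (K : osc) : regular (osc_pc K).
Proof.
intros p hp; apply simplicial_not_irregular; exact (proj2 (proj1 (oscP K) p hp)).
Qed.

Definition osc_rpc (K : osc) : rpc := RPC (@osc_regular K).

Lemma osc_triangle (V : Type) (K : list V -> Prop) : is_osc K ->
  forall m a b r c, K (a :: b :: m ++ c :: r) -> K [a; b; c].
Proof.
intros (_ & _ & h3) m a b r c; revert m.
assert (hr : forall r', K ([a; b; c] ++ r') -> K [a; b; c]).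
{ induction r' as [| x r' IH]; [now rewrite app_nil_r |].
  intros h; apply IH, (h3 [a; b; c] x r'); [discriminate | exact h]. }
induction m as [| x m IH]; intros h.
- exact (hr r h).
- apply IH, (h3 [a; b] x (m ++ c :: r)); [discriminate | exact h].
Qed.

Lemma tc_weak_aux (K1 K2 : osc) (f : tc_morphism K1 K2) p :
  opaths p -> ~ simplicial (map f p) -> irregular (map f p).
Proof.
induction p as [| a p IH]; intros hp ns; [destruct ns; constructor |].
destruct p as [| b p]; [destruct ns; repeat constructor; auto |].
destruct (classic (simplicial (map f (b :: p)))) as [s | s].
- destruct (classic (In (f a) (map f (b :: p)))) as [i | i];
    [| destruct ns; now constructor].
  exists [], (f a), (map f p); simpl in *.
  destruct i as [-> | i]; [reflexivity |].
  apply in_map_iff in i; destruct i as (c & e & ic).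
  apply in_split in ic; destruct ic as (m & r & ->).
  destruct (proj2 (tfunP f) _ _ _ (osc_triangle (oscP K1) hp) (eq_sym e))
    as [-> _]; reflexivity.
- assert (hb : opaths (b :: p)).
  { apply (proj2 (proj2 (oscP K1)) [] a (b :: p)); [discriminate | exact hp]. }
  destruct (IH hb s) as (l & v & r & e).
  exists (f a :: l), v, r; simpl in *; now rewrite e.
Qed.

Lemma tc_weak (K1 K2 : osc) (f : tc_morphism K1 K2) :
  @is_weak_path_morphism (osc_pc K1) (osc_pc K2) f.
Proof.
intros p hp; destruct (proj1 (tfunP f) p hp) as [h | h]; [left | now right].
now apply tc_weak_aux.
Qed.

Definition inclusion_map (K1 K2 : osc) (f : tc_morphism K1 K2) :
  weak_path_morphism (osc_pc K1) (osc_pc K2) :=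
  WeakPathMorphism (tc_weak f).

Definition inclusion : functor TcOSC WkRPC.
Proof.
refine (@Functor TcOSC WkRPC osc_rpc inclusion_map _ _);
  intros; now apply weak_path_morphism_eq.
Defined.

(** [{0,1}] is [bool], with [false] for [0] and [true] for [1]. *)

Definition iota0 (V : Type) (v : V) : V * bool := (v, false).
Definition iota1 (V : Type) (v : V) : V * bool := (v, true).

(** In [cyl_cross] the vertex [v] is [v_i], with [i = length l]. *)
Inductive cyl_paths (V : Type) (P : list V -> Prop) : list (V * bool) -> Prop :=
| cyl_bottom p : P p -> cyl_paths P (map (@iota0 V) p)
| cyl_top p : P p -> cyl_paths P (map (@iota1 V) p)
| cyl_cross l v r : P (l ++ v :: r) ->
    cyl_paths P (map (@iota0 V) (l ++ [v]) ++ map (@iota1 V) (v :: r)).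

Lemma cyl_path_complex (V : Type) (P : list V -> Prop) :
  is_path_complex P -> is_path_complex (cyl_paths P).
Proof.
intros (h1 & h2 & h3 & h4); split; [|split; [|split]].
- intros q [p hp | p hp | l v r _] e.
  + apply map_eq_nil in e; exact (h1 p hp e).
  + apply map_eq_nil in e; exact (h1 p hp e).
  + apply app_eq_nil in e; now destruct e as [_ e].
- intros [v []].
  + exact (cyl_top (h2 v)).
  + exact (cyl_bottom (h2 v)).
- intros x q nq h; remember (x :: q) as q' eqn:e.
  destruct h as [p hp | p hp | l v r hp].
  + destruct p as [| a p]; [discriminate e |]; injection e as _ <-.
    apply cyl_bottom, (h3 a); auto; intros ->; now apply nq.
  + destruct p as [| a p]; [discriminate e |]; injection e as _ <-.
    apply cyl_top, (h3 a); auto; intros ->; now apply nq.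
  + destruct l as [| a l]; injection e as _ <-.
    * exact (cyl_top hp).
    * apply cyl_cross, (h3 a); auto; now destruct l.
- intros q x nq h; remember (q ++ [x]) as q' eqn:e.
  destruct h as [p hp | p hp | l v r hp].
  + destruct p as [| a p _] using rev_ind; [now destruct q |].
    rewrite map_app in e; apply app_inj_tail in e; destruct e as [<- _].
    apply cyl_bottom, (h4 p a); auto; intros ->; now apply nq.
  + destruct p as [| a p _] using rev_ind; [now destruct q |].
    rewrite map_app in e; apply app_inj_tail in e; destruct e as [<- _].
    apply cyl_top, (h4 p a); auto; intros ->; now apply nq.
  + destruct r as [| a r _] using rev_ind.
    * apply app_inj_tail in e; destruct e as [<- _].
      exact (cyl_bottom hp).
    * rewrite app_comm_cons, (map_app _ (v :: r)), app_assoc in e.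
      apply app_inj_tail in e; destruct e as [<- _].
      apply cyl_cross, (h4 _ a); [now destruct l |].
      now rewrite <- app_assoc.
Qed.

Definition Cyl (P : path_complex) : path_complex :=
  PathComplex (cyl_path_complex (path_complexP P)).

Lemma cyl_simplicial (V : Type) (K : list V -> Prop) : is_osc K ->
  forall q, cyl_paths K q -> simplicial q.
Proof.
intros (h1 & _ & _) q h.
assert (i0 : forall p : list V, NoDup p -> NoDup (map (@iota0 V) p)).
{ intros p; apply Injective_map_NoDup; now intros x y [= ->]. }
assert (i1 : forall p : list V, NoDup p -> NoDup (map (@iota1 V) p)).
{ intros p; apply Injective_map_NoDup; now intros x y [= ->]. }
destruct h as [p hp | p hp | l v r hp].
- apply i0; exact (proj2 (h1 p hp)).
- apply i1; exact (proj2 (h1 p hp)).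
- destruct (h1 _ hp) as [_ nd]; apply NoDup_app.
  + apply i0; change (v :: r) with ([v] ++ r) in nd.
    rewrite app_assoc in nd; exact (NoDup_app_remove_r _ _ nd).
  + apply i1; exact (NoDup_app_remove_l _ _ nd).
  + intros [x b] hx hy; apply in_map_iff in hx, hy.
    destruct hx as (? & [= _ <-] & _), hy as (? & [=] & _).
Qed.

(** The smallest ordered simplicial complex on [V] containing [A], as an
    intersection.  Such a complex exists only when all members of [A] are
    simplicial and non-empty (see [osc_closure_osc]). *)
Definition osc_closure_paths (V : Type) (A : list V -> Prop) : list V -> Prop :=
  fun p => forall K, is_osc K -> (forall q, A q -> K q) -> K p.

Lemma osc_closure_osc (V : Type) (A : list V -> Prop) :
  (forall q, A q -> q <> [] /\ simplicial q) -> is_osc (osc_closure_paths A).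
Proof.
intros hA; split; [|split].
- intros p hp; apply (hp (fun q => q <> [] /\ simplicial q)); [| exact hA].
  split; [|split].
  + auto.
  + intros v; split; [discriminate | repeat constructor; auto].
  + intros l v r n [_ nd]; split; [exact n | exact (NoDup_remove_1 _ _ _ nd)].
- intros v K hK _; exact (proj1 (proj2 hK) v).
- intros l v r n h K hK hAK.
  apply (proj2 (proj2 hK) l v r n), (h K hK hAK).
Qed.

Lemma cyl_closure_osc (K : osc) :
  is_osc (osc_closure_paths (@paths (Cyl (osc_pc K)))).
Proof.
apply osc_closure_osc; intros q hq; split.
- exact (proj1 (path_complexP (Cyl (osc_pc K))) q hq).
- exact (cyl_simplicial (oscP K) hq).
Qed.

Definition CylBar (K : osc) : osc := OSC (cyl_closure_osc K).

Definition S_WkRPC : system WkRPC.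
Proof.
refine (@System WkRPC (fun P1 P2 f g => f <> g /\
  exists F : weak_path_morphism (Cyl P1) P2,
    (forall v, F (iota0 v) = f v) /\ (forall v, F (iota1 v) = g v)) _).
intros P1 P2 f [n _]; exact (n eq_refl).
Defined.

Definition S_TcOSC : system TcOSC.
Proof.
refine (@System TcOSC (fun K1 K2 f g => f <> g /\
  exists F : tc_morphism (CylBar K1) K2,
    (forall v, F (iota0 v) = f v) /\ (forall v, F (iota1 v) = g v)) _).
intros K1 K2 f [n _]; exact (n eq_refl).
Defined.

(* Main.v *)
From Stdlib Require Import List FunctionalExtensionality PropExtensionality
  ProofIrrelevance.
Require Import Defs.
Import ListNotations.

Set Implicit Arguments.
Unset Strict Implicit.
Unset Printing Implicit Defensive.

(** Since the inclusion is faithful, an edge of the pulled-back system is a pair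
    of distinct morphisms [f], [g] joined by a weak path morphism on the cylinder
    [Cyl K1], and the claim is that the same vertex map is then a
    triangle-collapsing morphism on the simplicial closure [CylBar K1].  The
    converse is immediate, as triangle-collapsing morphisms are weak path
    morphisms and [Cyl K1] is contained in [CylBar K1].

    The inclusion is also full ([weak_tc]), so nothing need be said about
    triangles: it is enough that a weak path morphism [F] on [Cyl K1] remains a
    weak path morphism on [CylBar K1] ([cylbar_weak]).  The new paths of the
    closure run along the bottom through [l] and jump to the top to run through
    [r], where [l ++ r] is in [K1] ([closure_cylbar]).  The heart of the proof
    is [jump_weak], which treats such a path by moving the jump towards its
    start. *)

(** * Irregular sequences *)

Lemma irregular_app (V : Type) (l p r : list V) :
  irregular p -> irregular (l ++ p ++ r).
Proof.
intros (l' & v & r' & ->); exists (l ++ l'), v, (r' ++ r).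
now rewrite <- !app_assoc.
Qed.

Lemma irregular_cons2 (V : Type) (x y : V) p :
  irregular (x :: y :: p) -> x = y \/ irregular (y :: p).
Proof.
intros ([| z l] & v & r & e).
- injection e as -> -> _; now left.
- injection e as _ e; right; now exists l, v, r.
Qed.

Lemma irregular_split (V : Type) (p : list V) x q :
  irregular (p ++ x :: q) -> irregular (p ++ [x]) \/ irregular (x :: q).
Proof.
induction p as [| a p IH]; [now right |]; intros h.
destruct p as [| b p].
- destruct (irregular_cons2 h) as [-> | h']; [left | now right].
  now exists [], x, [].
- destruct (irregular_cons2 h) as [-> | h'].
  + left; now exists [], b, (p ++ [x]).
  + destruct (IH h') as [i | i]; [left | now right].
    destruct i as (l & v & r & e); exists (a :: l), v, r.
    simpl in *; now rewrite e.
Qed.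

(** * Fullness of the inclusion *)

(** If [f v0 = f v2] then the image of the path [v0 v1 v2] is not simplicial, so
    it must be irregular; hence two consecutive images agree, and all three
    do. *)
Lemma weak_tc (K1 K2 : osc) (f : overt K1 -> overt K2) :
  @is_weak_path_morphism (osc_pc K1) (osc_pc K2) f -> is_tc_morphism f.
Proof.
intros hf; split.
- intros p hp; destruct (hf p hp) as [h | h]; [left | now right].
  intros s; exact (simplicial_not_irregular s h).
- intros v0 v1 v2 hp e; destruct (hf _ hp) as [h | h]; simpl in h.
  + destruct (irregular_cons2 h) as [e' | h'].
    { split; congruence. }
    destruct (irregular_cons2 h') as [e' | h''].
    { split; congruence. }
    destruct h'' as ([| x [| y l]] & v & r & e'); discriminate e'.
  + destruct (proj1 (oscP K2) _ h) as [_ nd]; rewrite e in nd.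
    exfalso; apply (NoDup_remove_2 [] _ _ nd); simpl; auto.
Qed.

(** * The simplicial closure of the cylinder *)

(** [jump] allows [l] or [r] to be empty, so that it includes the bottom and the
    top copies of [K]. *)
Inductive cylbar_paths (V : Type) (K : list V -> Prop) : list (V * bool) -> Prop :=
| cylbar_jump l r : K (l ++ r) ->
    cylbar_paths K (map (@iota0 V) l ++ map (@iota1 V) r)
| cylbar_cross l v r : K (l ++ v :: r) ->
    cylbar_paths K (map (@iota0 V) (l ++ [v]) ++ map (@iota1 V) (v :: r)).

Lemma cyl_cylbar (V : Type) (K : list V -> Prop) q :
  cyl_paths K q -> cylbar_paths K q.
Proof.
intros [p hp | p hp | l v r hp].
- rewrite <- (app_nil_r (map _ p)); apply (@cylbar_jump V K p []).
  now rewrite app_nil_r.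
- now apply (@cylbar_jump V K [] p).
- now apply cylbar_cross.
Qed.

Lemma app_eq_app_cons (V : Type) (a b l : list V) x r :
  a ++ b = l ++ x :: r ->
  (exists m, a = l ++ x :: m /\ r = m ++ b) \/
  (exists m, b = m ++ x :: r /\ l = a ++ m).
Proof.
intros e; apply app_eq_app in e; destruct e as (m & [[-> e] | [-> ->]]).
- destruct m as [| y m].
  + right; exists []; simpl in *; now rewrite e, !app_nil_r.
  + left; injection e as -> ->; now exists m.
- right; now exists m.
Qed.

(** Deleting one of the two copies of the crossing vertex turns a crossing into a
    jump; every other deletion comes from a deletion in [K]. *)
Lemma cylbar_delete (V : Type) (K : list V -> Prop) : is_osc K ->
  forall l x r, l ++ r <> [] ->
  cylbar_paths K (l ++ x :: r) -> cylbar_paths K (l ++ r).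
Proof.
intros (_ & _ & hK) l x r n h; remember (l ++ x :: r) as q eqn:e.
destruct h as [l0 r0 hp | l0 v r0 hp];
  apply app_eq_app_cons in e; destruct e as [(m & e & ->) | (m & e & ->)];
  apply map_eq_app in e; destruct e as (p1 & p2 & e & <- & e');
  apply map_eq_cons in e'; destruct e' as (y & p3 & -> & <- & <-).
- subst l0; rewrite app_assoc, <- map_app; apply cylbar_jump.
  rewrite <- app_assoc; apply (hK _ y).
  + intros e; apply n; apply app_eq_nil in e; destruct e as [-> e].
    apply app_eq_nil in e; now destruct e as [-> ->].
  + now rewrite <- app_assoc in hp.
- subst r0; rewrite <- app_assoc, <- map_app; apply cylbar_jump.
  rewrite app_assoc; apply (hK _ y).
  + intros e; apply n; apply app_eq_nil in e; destruct e as [e ->].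
    apply app_eq_nil in e; now destruct e as [-> ->].
  + now rewrite <- app_assoc.
- rewrite app_assoc, <- map_app.
  destruct p3 as [| z p3 _] using rev_ind.
  + apply app_inj_tail in e; destruct e as [-> ->].
    rewrite app_nil_r; now apply cylbar_jump.
  + rewrite app_comm_cons, app_assoc in e; apply app_inj_tail in e.
    destruct e as [-> ->].
    rewrite app_assoc; apply cylbar_cross; rewrite <- app_assoc.
    apply (hK _ y); [now destruct p1, p3 |].
    now rewrite <- app_assoc in hp.
- rewrite <- app_assoc, <- map_app.
  destruct p1 as [| z p1]; injection e as -> e.
  + subst r0; apply cylbar_jump; now rewrite <- app_assoc.
  + subst r0; apply cylbar_cross.
    change (K (l0 ++ (z :: p1) ++ p3)); rewrite app_assoc.
    apply (hK _ y); [now destruct l0 | now rewrite <- app_assoc].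
Qed.

Lemma closure_cylbar (V : Type) (K : list V -> Prop) : is_osc K ->
  forall q, osc_closure_paths (cyl_paths K) q -> cylbar_paths K q.
Proof.
intros hK q hq.
(* Demanding simplicial paths spares a separate proof that jumps are. *)
apply (hq (fun q => (q <> [] /\ simplicial q) /\ cylbar_paths K q)).
- split; [| split].
  + now intros p [h _].
  + intros [v b]; split.
    * split; [discriminate | repeat constructor; auto].
    * destruct hK as (_ & h1 & _); destruct b.
      -- exact (@cylbar_jump V K [] [v] (h1 v)).
      -- exact (@cylbar_jump V K [v] [] (h1 v)).
  + intros l v r n [[_ nd] h]; split.
    * split; [exact n | exact (NoDup_remove_1 _ _ _ nd)].
    * exact (cylbar_delete hK n h).
- intros p hp; split; [split |].
  + exact (proj1 (cyl_path_complex (osc_path_complex hK)) p hp).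
  + exact (cyl_simplicial hK hp).
  + now apply cyl_cylbar.
Qed.

(** * Extending weak path morphisms from the cylinder to its closure *)

(** Write [f], [g] for [F] on the bottom and on the top, and let the jump go from
    [a] to [b].  Inserting [(a,1)] gives a crossing, a path of the cylinder.
    If its image is in [K2], delete [g a].  Otherwise the image of the crossing
    is irregular; unless the image of the jump is irregular too, the repetition
    involves [g a].  If [g a = g b], the jump has the same image as the crossing
    at [a] over the path with [b] deleted.  If [f a = g a], the jump has
    the same image as the one from the vertex before [a] to [a], and induction
    applies; a jump at the very start lies in the top copy. *)
Lemma jump_weak (K1 K2 : osc) (F : overt K1 * bool -> overt K2) :
  @is_weak_path_morphism (Cyl (osc_pc K1)) (osc_pc K2) F ->
  forall l r, opaths (l ++ r) ->
  let q := map F (map (@iota0 _) l ++ map (@iota1 _) r) in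
  irregular q \/ opaths q.
Proof.
intros hF l; induction l as [| a l IH] using rev_ind; intros r hp.
- exact (hF _ (@cyl_top _ (@opaths K1) r hp)).
- destruct r as [| b r].
  { rewrite app_nil_r in hp.
    simpl; rewrite app_nil_r.
    exact (hF _ (@cyl_bottom _ (@opaths K1) _ hp)). }
  rewrite <- app_assoc in hp; simpl in hp.
  assert (hab := hF _ (@cyl_cross _ (@opaths K1) l a (b :: r) hp)).
  assert (ha : opaths (l ++ a :: r)).
  { change (a :: r) with ([a] ++ r); rewrite app_assoc.
    apply (proj2 (proj2 (oscP K1)) (l ++ [a]) b r);
      [now destruct l | now rewrite <- app_assoc]. }
  apply (@cyl_cross _ (@opaths K1)) in ha; apply hF in ha.
  specialize (IH (a :: b :: r) hp).
  revert hab ha IH; simpl; rewrite !map_app; simpl; rewrite <- !app_assoc; simpl.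
  generalize (map F (map (@iota0 _) l)) as fl, (map F (map (@iota1 _) r)) as gr.
  intros fl gr hab ha IH.
  destruct hab as [hab | hab].
  + destruct (irregular_split hab) as [i | i].
    { left; apply (@irregular_app _ [] _ (F (iota1 b) :: gr)) in i.
      simpl in i; now rewrite <- app_assoc in i. }
    destruct (irregular_cons2 i) as [-> | i']; [exact IH |].
    destruct (irregular_cons2 i') as [<- | i'']; [exact ha |].
    left; apply (@irregular_app _ (fl ++ [F (iota0 a)]) _ []) in i''.
    now rewrite app_nil_r, <- app_assoc in i''.
  + right; change (F (iota0 a) :: F (iota1 b) :: gr)
      with ([F (iota0 a)] ++ F (iota1 b) :: gr).
    rewrite app_assoc; apply (proj2 (proj2 (oscP K2)) _ (F (iota1 a))).
    * now destruct fl.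
    * now rewrite <- app_assoc.
Qed.

Lemma cylbar_weak (K1 K2 : osc) (F : overt K1 * bool -> overt K2) :
  @is_weak_path_morphism (Cyl (osc_pc K1)) (osc_pc K2) F ->
  @is_weak_path_morphism (osc_pc (CylBar K1)) (osc_pc K2) F.
Proof.
intros hF q hq; destruct (closure_cylbar (oscP K1) hq) as [l r hp | l v r hp].
- exact (jump_weak hF hp).
- exact (hF _ (@cyl_cross _ (@opaths K1) l v r hp)).
Qed.

(** * Comparison of the two systems *)

Lemma inclusion_faithful (K1 K2 : osc) (f g : tc_morphism K1 K2) :
  inclusion_map f = inclusion_map g -> f = g.
Proof.
intros e; apply tc_morphism_eq.
exact (f_equal (@wfun (osc_pc K1) (osc_pc K2)) e).
Qed.

Lemma system_ext (C : category) (S T : system C) :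
  (forall (C1 C2 : C) (f g : mor C1 C2), edge S f g <-> edge T f g) -> S = T.
Proof.
destruct S as [s hs], T as [t ht]; simpl; intros e.
assert (st : s = t).
{ extensionality C1; extensionality C2; extensionality f; extensionality g.
  apply propositional_extensionality, e. }
subst t; f_equal; apply proof_irrelevance.
Qed.

Theorem corollary4p9 : pullback inclusion S_WkRPC = S_TcOSC.
Proof.
apply system_ext; intros K1 K2 f g; split.
- intros [n [e | [_ (F & F0 & F1)]]].
  + now destruct (n (inclusion_faithful e)).
  + split; [exact n |].
    now exists (@TcMorphism (CylBar K1) K2 F (weak_tc (cylbar_weak (wfunP F)))).
- intros [n (F & F0 & F1)]; split; [exact n | right; split].
  + intros e; exact (n (inclusion_faithful e)).
  + assert (hF : @is_weak_path_morphism (Cyl (osc_pc K1)) (osc_pc K2) F).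
    { intros q hq; apply (tc_weak F); intros L _ hL; exact (hL q hq). }
    now exists (WeakPathMorphism hF).
Qed.
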